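(* Let $(V,K,u)$ be an order unit space and let $x,y\in K^\circ$ be linearly independent. Let $m_{xy}$ be the canonical midpoint of $x$ and $y$. Whenever $M(x/y)>1$ put \[ y':=\frac{M(x/y)}{M(x/y)-1}\,y+\frac{1}{1-M(x/y)}\,x , \] and whenever $M(y/x)>1$ put \[ x':=\frac{M(y/x)}{M(y/x)-1}\,x+\frac{1}{1-M(y/x)}\,y . \] Then the affine span of the midpoints set $\mathcal{M}(x,y)$ satisfies: (i) $\mathrm{aff}\,\mathcal{M}(x,y)=m_{xy}+\mathrm{span}\,F_{y'}$, if $M(x/y)>M(y/x)$; (ii) $\mathrm{aff}\,\mathcal{M}(x,y)=m_{xy}+\mathrm{span}\,F_{x'}$, if $M(y/x)>M(x/y)$; (iii) $\mathrm{aff}\,\mathcal{M}(x,y)=m_{xy}+\big(\mathrm{span}\,F_{x'}\cap\mathrm{span}\,F_{y'}\big)$, if $M(x/y)=M(y/x)$.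
   Context: A cone $K$ in a real vector space $V$ is a convex subset with $K\cap(-K)=\{0\}$ and $\lambda K\subseteq K$ for all $\lambda\ge 0$; it induces the partial order $x\le_K y \iff y-x\in K$. $K$ is Archimedean if for all $x\in V$, $y\in K$ with $nx\le_K y$ for all $n\ge 1$ one has $x\le_K 0$. An element $u\in K$ is an order unit if for each $x\in V$ there is $\lambda>0$ with $x\le_K\lambda u$. The triple $(V,K,u)$ is an order unit space if $K$ is Archimedean and $u$ is an order unit. $V$ is equipped with the order unit norm $\|x\|_u:=\inf\{\lambda>0:-\lambda u\le_K x\le_K\lambda u\}$; $K$ is closed for this norm, and its interior $K^\circ$ is the set of order units of $K$. For $x,y\in K^\circ$ let $M(x/y):=\inf\{\beta>0: x\le_K\beta y\}<\infty$. Thompson's metric on $K^\circ$ is $d_T(x,y):=\log(\max\{M(x/y),M(y/x)\})$, and the midpoints set is $\mathcal{M}(x,y):=\{z\in K^\circ: d_T(x,z)=\tfrac12 d_T(x,y)=d_T(z,y)\}$. For $z\in K$, the face of $K$ generated by $z$ is $F_z:=\{y\in K:\lambda y+(1-\lambda)z\in K\text{ for some }\lambda<0\}$. Canonical midpoint: for linearly independent $x,y\in K^\circ$ let $V(x,y)=\mathrm{span}(x,y)$ and $K(x,y)=V(x,y)\cap K$. There are linearly independent linear functionals $\psi_1,\psi_2$ on $V(x,y)$ with $K(x,y)=\{z\in V(x,y):\psi_1(z)\ge 0\text{ and }\psi_2(z)\ge 0\}$. Let $\Psi:V(x,y)\to\mathbb{R}^2$ be the linear bijection $\Psi(z)=(\psi_1(z),\psi_2(z))$.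 The canonical geodesic is $\gamma_{xy}(t):=\Psi^{-1}(\Psi(x)^{1-t}\Psi(y)^t)$, $t\in[0,1]$ (powers and products coordinatewise), and the canonical midpoint is $m_{xy}:=\gamma_{xy}(1/2)$, i.e. $\psi_i(m_{xy})=\sqrt{\psi_i(x)\psi_i(y)}$ for $i=1,2$. $\mathrm{aff}\,W$ and $\mathrm{span}\,W$ denote the affine span and linear span of $W\subseteq V$. In case (i) one has $M(x/y)>1$, in case (ii) $M(y/x)>1$, and in case (iii) $M(x/y)=M(y/x)>1$, so the points used in each case are defined. *)

(* Defs.v *)
From HB Require Import structures.
From mathcomp Require Import all_boot all_order all_algebra.
From mathcomp Require Import all_classical all_reals all_analysis.
Set Implicit Arguments.
Unset Strict Implicit.
Unset Printing Implicit Defensive.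
Import Order.TTheory GRing.Theory Num.Theory.
Local Open Scope classical_set_scope.
Local Open Scope ring_scope.

Section Spans.
Variables (R : realType) (V : lmodType R).
Implicit Types W : set V.

Definition lin_span W : set V :=
  [set v | exists n (a : 'I_n -> R) (w : 'I_n -> V),
    (forall i, W (w i)) /\ v = \sum_i a i *: w i].

Definition aff_span W : set V :=
  [set v | exists n (a : 'I_n -> R) (w : 'I_n -> V),
    [/\ forall i, W (w i), \sum_i a i = 1 & v = \sum_i a i *: w i]].

Definition translate (m : V) W : set V := [set m + w | w in W].

Definition lin_indep2 (x y : V) :=
  forall a b : R, a *: x + b *: y = 0 -> a = 0 /\ b = 0.

(* psi is only constrained on W: it stands for a functional defined on the
   subspace W, its values elsewhere being irrelevant. *)
Definition linear_on W (psi : V -> R) :=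
  forall (a : R) (v w : V), W v -> W w -> psi (a *: v + w) = a * psi v + psi w.

Definition lin_indep2_on W (psi1 psi2 : V -> R) :=
  forall a b : R, (forall v, W v -> a * psi1 v + b * psi2 v = 0) ->
  a = 0 /\ b = 0.

End Spans.

Section OrderUnitSpaces.
Variables (R : realType) (V : lmodType R).
Implicit Types (K : set V) (u x y z : V).

Definition cone K :=
  [/\ convex_set K,
      K `&` [set - x | x in K] = [set 0]
    & forall (l : R) x, 0 <= l -> K x -> K (l *: x)].

Definition cone_le K x y := K (y - x).

Definition archimedean K :=
  forall x y, K y -> (forall n : nat, (1 <= n)%N -> cone_le K (x *+ n) y) ->
  cone_le K x 0.

Definition order_unit K u :=
  K u /\ forall x, exists2 l : R, 0 < l & cone_le K x (l *: u).

Definition order_unit_space K u :=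
  [/\ cone K, archimedean K & order_unit K u].

Definition ou_norm K u x : R :=
  inf [set l : R | [/\ 0 < l, cone_le K (- (l *: u)) x & cone_le K x (l *: u)]].

(* The topological interior of K for the metric ou_norm K u (v - w). *)
Definition ou_interior K u : set V :=
  [set z | exists2 e : R, 0 < e & forall w, ou_norm K u (w - z) < e -> K w].

Definition Mratio K x y : R :=
  inf [set b : R | 0 < b /\ cone_le K x (b *: y)].

Definition thompson K x y : R := ln (Num.max (Mratio K x y) (Mratio K y x)).

Definition midpoints K u x y : set V :=
  [set z | [/\ ou_interior K u z,
               thompson K x z = 2^-1 * thompson K x y
             & thompson K z y = 2^-1 * thompson K x y]].

Definition face K z : set V :=
  [set y | K y /\ exists2 l : R, l < 0 & K (l *: y + (1 - l) *: z)].

Definition canonical_functionals K x y (psi1 psi2 : V -> R) :=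
  let Vxy := lin_span [set x; y] in
  [/\ linear_on Vxy psi1, linear_on Vxy psi2, lin_indep2_on Vxy psi1 psi2
    & Vxy `&` K = [set z | [/\ Vxy z, 0 <= psi1 z & 0 <= psi2 z]]].

(* The pair (psi1, psi2) is unique up to exchange and positive scalings, none
   of which affects the point selected here. *)
Definition canonical_geodesic K x y (t : R) : V :=
  xget 0 [set g | exists psi1 psi2 : V -> R,
    [/\ canonical_functionals K x y psi1 psi2,
        lin_span [set x; y] g,
        psi1 g = psi1 x `^ (1 - t) * psi1 y `^ t
      & psi2 g = psi2 x `^ (1 - t) * psi2 y `^ t]].

Definition canonical_midpoint K x y : V := canonical_geodesic K x y 2^-1.

(* The end point, beyond y, of the chord of K through x and y; meaningful when
   Mratio K x y > 1. *)
Definition endpoint K x y : V :=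
  let M := Mratio K x y in (M / (M - 1)) *: y + (1 / (1 - M)) *: x.

End OrderUnitSpaces.

(* Main.v *)
Require Import Defs.
From HB Require Import structures.
From mathcomp Require Import all_boot all_order all_algebra.
From mathcomp Require Import all_classical all_reals all_analysis.
From mathcomp Require Import ring lra.
Set Implicit Arguments.
Unset Strict Implicit.
Unset Printing Implicit Defensive.
Import Order.TTheory GRing.Theory Num.Theory.
Local Open Scope classical_set_scope.
Local Open Scope ring_scope.

(** Put [a = M(x/y)], [b = M(y/x)], say [b <= a], and let [r], [s] be the square
    roots of [a], [b]. The proof reduces everything to order intervals.

    Since the infimum defining [M] is attained ([MratioP], by the Archimedean
    property) and [M] is submultiplicative, [z] is a midpoint exactly when
    [r^-1 x <= z <= r y] and [r^-1 y <= z <= r x] ([midpointsP]).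

    The points [p = a y - x] and [q = b x - y] span the extremal rays of the
    planar cone through [x] and [y] ([planar_coneP]); in the coordinates along
    [p] and [q] the canonical midpoint [m] is a coordinatewise geometric mean
    ([canonical_midpointE]), which gives [m = (s x + r y) / (r s + 1)]
    ([canonical_midpoint_comb]). Hence the slacks [m - r^-1 x] and [r y - m] of
    the first two bounds at [m] are positive multiples of [p], while those of
    the other two are a positive multiple of [q] plus a nonnegative multiple of
    [y] or [x] whose coefficient vanishes exactly when [r = s].

    So [z = m + w] is a midpoint when [w] lies between negative and positive
    multiples of [p], and, in addition, either in a neighbourhood of [0] (if
    [s < r]) or between multiples of [q] (if [s = r]). Such a set of [w] is
    convex, contains [0] and spans linearly the space of all directions in which
    one can move both ways from [p] (and from [q]) inside [K]
    ([aff_span_box]); that space is the span of the face generated by [p]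
    (and [q]) ([lin_span_face]). The endpoint [y'] is a positive multiple of
    [p], and [x'] one of [q]. The case [a < b] follows by exchanging [x] and
    [y]. *)

(** * Identities in a module *)

Section Combinations.
Variables (R : realType) (V : lmodType R) (x y z : V).

(** Bookkeeping for [module_eq]: both sides of a vector identity are expanded
    over the same three vectors, so that only scalar identities remain. *)
Definition comb (v : V) (a b c : R) := v = a *: x + b *: y + c *: z.

Lemma comb1 : comb x 1 0 0.
Proof. by rewrite /comb scale1r !scale0r !addr0. Qed.

Lemma comb2 : comb y 0 1 0.
Proof. by rewrite /comb scale1r !scale0r addr0 add0r. Qed.

Lemma comb3 : comb z 0 0 1.
Proof. by rewrite /comb scale1r !scale0r !add0r. Qed.

Lemma comb0 : comb 0 0 0 0.
Proof. by rewrite /comb !scale0r !addr0. Qed.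

Lemma combD v w a b c a' b' c' : comb v a b c -> comb w a' b' c' ->
  comb (v + w) (a + a') (b + b') (c + c').
Proof.
move=> -> ->; rewrite /comb !scalerDl addrACA; congr (_ + _).
by rewrite addrACA.
Qed.

Lemma combZ k v a b c : comb v a b c -> comb (k *: v) (k * a) (k * b) (k * c).
Proof. by move=> ->; rewrite /comb !scalerDr !scalerA. Qed.

Lemma combN v a b c : comb v a b c -> comb (- v) (- a) (- b) (- c).
Proof. by move=> ->; rewrite /comb !scaleNr !opprD. Qed.

Lemma comb_eq v w a b c a' b' c' : comb v a b c -> comb w a' b' c' ->
  a = a' -> b = b' -> c = c' -> v = w.
Proof. by move=> -> -> -> -> ->. Qed.

End Combinations.

Ltac comb :=
  lazymatch goal with
  | |- comb _ _ _ 0 _ _ _ => exact: comb0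
  | |- comb _ _ _ (_ + _) _ _ _ => apply: combD; comb
  | |- comb _ _ _ (- _) _ _ _ => apply: combN; comb
  | |- comb _ _ _ (_ *: _) _ _ _ => apply: combZ; comb
  | _ => first [exact: comb1 | exact: comb2 | exact: comb3]
  end.

Ltac module_eq x y z :=
  eapply (@comb_eq _ _ x y z); [comb | comb | | | ].

Section Cones.
Variables (R : realType) (V : lmodType R) (K : set V).
Hypothesis coneK : cone K.
Implicit Types (c d v w x y z t : V).

(** * Cones and the directions of their faces *)

Lemma coneZ (l : R) x : 0 <= l -> K x -> K (l *: x).
Proof. by case: coneK => _ _; apply. Qed.

Lemma coneD x y : K x -> K y -> K (x + y).
Proof.
move=> Kx Ky; case: coneK => cvx _ _.
have h0 : (0 : R) <= 2^-1 by lra.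
have h1 : (2^-1 : R) <= 1 by lra.
have /set_mem := cvx _ _ (Itv01 h0 h1) (mem_set Kx) (mem_set Ky).
move=> /(coneZ (ler0n R 2)); congr (K _).
rewrite /conv /= /unstable.onem.
module_eq x y y; by field.
Qed.

Lemma coneP v w (a b : R) t :
  K v -> K w -> 0 <= a -> 0 <= b -> t = a *: v + b *: w -> K t.
Proof. by move=> Kv Kw a0 b0 ->; apply: coneD; apply: coneZ. Qed.

Lemma cone_pointed v : K v -> K (- v) -> v = 0.
Proof.
move=> Kv KNv; case: coneK => _ KNK _.
suff : (K `&` [set - x | x in K]) v by rewrite KNK.
by split => //; exists (- v); rewrite ?opprK.
Qed.

(** The directions in which one can move both ways from [c] without leaving
    [K]: the linear span of the face of [c], in a form that is easier to compare
    between points than the face itself. *)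
Definition feasible c : set V :=
  [set w | exists2 e : R, 0 < e & K (c + e *: w) /\ K (c - e *: w)].

Lemma feasible_le c w (e : R) : 0 < e -> K (c + e *: w) -> K (c - e *: w) ->
  forall s, `|s| <= e -> K (c + s *: w).
Proof.
move=> e0 Kp Km s; rewrite ler_norml => /andP[es se].
apply: (@coneP _ _ ((e + s) / (2 * e)) ((e - s) / (2 * e)) _ Kp Km).
- by apply: divr_ge0; lra.
- by apply: divr_ge0; lra.
- by module_eq c w w; field; lra.
Qed.

Lemma feasible0 c : K c -> feasible c 0.
Proof. by move=> Kc; exists 1 => //; rewrite scaler0 subr0 addr0. Qed.

Lemma feasibleZ c w k : feasible c w -> feasible c (k *: w).
Proof.
move=> [e e0 [Kp Km]].
have k0 : 0 < `|k| + 1 by rewrite ltr_wpDl.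
exists (e / (`|k| + 1)); first by apply: divr_gt0.
have bnd : `|e / (`|k| + 1) * k| <= e.
  rewrite !normrM normfV (gtr0_norm e0) (gtr0_norm k0) mulrAC ler_pdivrMr //.
  by rewrite ler_pM2l // lerDl.
rewrite scalerA -scaleNr; split; apply: (feasible_le e0 Kp Km) => //.
by rewrite normrN.
Qed.

Lemma feasibleD c v w : feasible c v -> feasible c w -> feasible c (v + w).
Proof.
move=> [e e0 [Kp Km]] [f f0 [Kp' Km']].
have ef : 0 < e + f by lra.
exists (e * f / (e + f)); first by apply: divr_gt0 => //; apply: mulr_gt0.
have p1 : 0 <= f / (e + f) by apply: divr_ge0; lra.
have p2 : 0 <= e / (e + f) by apply: divr_ge0; lra.
split; [apply: (coneP Kp Kp' p1 p2)|apply: (coneP Km Km' p1 p2)];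
  by module_eq c v w; field; lra.
Qed.

Lemma feasible_sum c n (a : 'I_n -> R) (w : 'I_n -> V) : K c ->
  (forall i, feasible c (w i)) -> feasible c (\sum_i a i *: w i).
Proof.
move=> Kc fw; elim/big_ind : _ => //; first exact: feasible0.
- exact: feasibleD.
- by move=> i _; apply: feasibleZ.
Qed.

(** A smaller element leaves less room: this is the comparison that makes the
    feasible directions of [c] depend only on the face that [c] generates. *)
Lemma feasible_mono c d k : 0 < k -> K (d - k *: c) ->
  feasible c `<=` feasible d.
Proof.
move=> k0 Kdc w [e e0 [Kp Km]]; exists (k * e); first exact: mulr_gt0.
by split; [apply: (coneP Kdc Kp (ler01) (ltW k0))
          |apply: (coneP Kdc Km (ler01) (ltW k0))]; module_eq c d w; ring.
Qed.

Lemma feasible_scale c k : K c -> 0 < k -> feasible (k *: c) = feasible c.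
Proof.
move=> Kc k0; have k1 : 0 < k^-1 by rewrite invr_gt0.
have K0 : K 0 by rewrite -(scale0r c); apply: coneZ.
apply/seteqP; split.
  apply: (@feasible_mono _ _ k^-1) => //.
  by rewrite scalerA mulVf ?gt_eqF // scale1r subrr.
by apply: (@feasible_mono _ _ k) => //; rewrite subrr.
Qed.

(** If [c +- e w] lie in [K], they lie in the face of [c], and [w] is a multiple
    of their difference; conversely an element of the face can be subtracted
    from [c] after scaling down. *)
Lemma lin_span_face c : K c -> lin_span (face K c) = feasible c.
Proof.
move=> Kc; apply/seteqP; split => w.
  move=> [n [a [v [fv ->]]]]; apply: feasible_sum => // i.
  have [Kv [l l0 Kl]] := fv i; have l1 : 0 < 1 - l by lra.
  exists (- l / (1 - l)); first by apply: divr_gt0; lra.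
  split.
    apply: (@coneP _ _ 1 (- l / (1 - l)) _ Kc Kv) => //.
      by apply: divr_ge0; lra.
    by rewrite scale1r.
  apply: (@coneP _ _ (1 - l)^-1 0 _ Kl Kc) => //; first by rewrite invr_ge0 ltW.
  by module_eq c (v i) c; field; lra.
move=> [e e0 [Kp Km]].
exists 2%N, (fun i => if i == ord0 then (2 * e)^-1 else - (2 * e)^-1).
exists (fun i => if i == ord0 then c + e *: w else c - e *: w); split.
  move=> i; case: ifP => _; split => //; exists (-1); rewrite ?ltrN10 //.
    by apply: (coneP Km Km ler01 (lexx 0)); module_eq c w w; ring.
  by apply: (coneP Kp Kp ler01 (lexx 0)); module_eq c w w; ring.
by rewrite big_ord_recl big_ord1 /=; module_eq c w w; field; lra.
Qed.

(** One-sided bounds at two points suffice when the points generate the same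
    face: a small multiple of [c2] can be subtracted from [c1], which carries
    the bound [w <= c2] over to [c1]. *)
Lemma feasible_between c1 c2 w : K c1 -> K c2 -> feasible c1 = feasible c2 ->
  K (c1 + w) -> K (c2 - w) -> feasible c1 w.
Proof.
move=> K1 K2 c12 Kp Km.
have : feasible c1 c2 by rewrite c12; exists 1 => //; rewrite scale1r subrr;
  split; [apply: coneD|rewrite -(scale0r c2); apply: coneZ].
clear c12 => -[e e0 [_ Ke]].
have e1 : 0 < 1 + e by lra.
have p1 : 0 <= (1 + e)^-1 by rewrite invr_ge0 ltW.
have p2 : 0 <= e / (1 + e) by apply: divr_ge0; lra.
exists (e / (1 + e)); first by apply: divr_gt0.
split.
  by apply: (coneP K1 Kp p1 p2); module_eq c1 w w; field; lra.
have K12 : K (c1 - e *: w).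
  by apply: (coneP Ke Km ler01 (ltW e0)); module_eq c1 c2 w; ring.
apply: (@coneP _ _ (e / (1 + e)) (1 + e)^-1 _ K1 K12) => //.
by module_eq c1 w w; field; lra.
Qed.

(** The set of all [m + w] with [- c1 <= w <= c2] and [- d1 <= w <= d2] is
    convex, contains [m], and absorbs exactly the common feasible directions
    of the bounds, so these directions span it affinely. *)
Lemma aff_span_box (W : set V) m c1 c2 d1 d2 :
  K c1 -> K c2 -> K d1 -> K d2 ->
  feasible c1 = feasible c2 -> feasible d1 = feasible d2 ->
  (forall w, W (m + w) <->
     [/\ K (c1 + w), K (c2 - w), K (d1 + w) & K (d2 - w)]) ->
  aff_span W = translate m (feasible c1 `&` feasible d1).
Proof.
move=> Kc1 Kc2 Kd1 Kd2 c12 d12 WP; apply/seteqP; split => z.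
  move=> [n [a [w [Ww a1 ->]]]].
  exists (\sum_i a i *: (w i - m)); last first.
    under eq_bigr do rewrite scalerBr.
    by rewrite sumrB -scaler_suml a1 scale1r addrC subrK.
  split; apply: feasible_sum => // i;
    have : W (m + (w i - m)) by rewrite addrC subrK.
    by move=> /WP[h1 h2 _ _]; apply: feasible_between h1 h2.
  by move=> /WP[_ _ h1 h2]; apply: feasible_between h1 h2.
move=> [w [fc fd] <-{z}].
have [e1 e10 [p1 _]] := fc.
have [e2 e20 [_ p2]] : feasible c2 w by rewrite -c12.
have [e3 e30 [p3 _]] := fd.
have [e4 e40 [_ p4]] : feasible d2 w by rewrite -d12.
have shrink c v (e t : R) : 0 < e -> 0 <= t <= e -> K c -> K (c + e *: v) ->
    K (c + t *: v).
  move=> e0 /andP[t0 te] Kc Ke.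
  apply: (@coneP _ _ (1 - t / e) (t / e) _ Kc Ke).
  - by rewrite subr_ge0 ler_pdivrMr // mul1r.
  - by apply: divr_ge0 => //; apply: ltW.
  - by module_eq c v v; field; rewrite gt_eqF.
(* one step length for the four bounds; then [m + w] is an affine combination
   of [m] and [m + e w] *)
pose e := Num.min (Num.min e1 e2) (Num.min e3 e4).
have e0 : 0 < e by rewrite !lt_min e10 e20 e30 e40.
have /and4P[l1 l2 l3 l4] : [&& e <= e1, e <= e2, e <= e3 & e <= e4].
  by rewrite !ge_min !lexx !orbT.
have Wm : W m.
  by rewrite -(addr0 m); apply/WP; rewrite !subr0 !addr0.
have We : W (m + e *: w).
  apply/WP; rewrite -scalerN; split.
  - by apply: (shrink _ _ e1) => //; rewrite ltW.
  - by apply: (shrink _ _ e2) => //; rewrite ?scalerN // ltW.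
  - by apply: (shrink _ _ e3) => //; rewrite ltW.
  - by apply: (shrink _ _ e4) => //; rewrite ?scalerN // ltW.
exists 2%N, (fun i => if i == ord0 then 1 - e^-1 else e^-1).
exists (fun i => if i == ord0 then m else m + e *: w); split.
- by move=> i; case: ifP.
- by rewrite big_ord_recl big_ord1 /= subrK.
- by rewrite big_ord_recl big_ord1 /=; module_eq m w w; field; rewrite gt_eqF.
Qed.

End Cones.

Section OrderUnit.
Variables (R : realType) (V : lmodType R) (K : set V) (u : V).
Hypothesis hKu : order_unit_space K u.
Implicit Types (v w x y z : V).

Let coneK : cone K. Proof. by case: hKu. Qed.

(** * Interior points and extremal ratios *)

(** An order unit absorbs every vector, hence lies off every proper face. *)
Lemma feasible_unit w : feasible K u w.
Proof.
case: hKu => _ _ [Ku hu].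
have [l1 l10 h1] := hu w; have [l2 l20 h2] := hu (- w).
have l0 : 0 < l1 + l2 by lra.
have p0 : 0 <= (l1 + l2)^-1 by rewrite invr_ge0 ltW.
exists (l1 + l2)^-1; first by rewrite invr_gt0.
split.
  apply: (@coneP _ _ _ coneK _ _ (l1 + l2)^-1 (l1 / (l1 + l2)) _ h2 Ku) => //.
    by apply: divr_ge0; lra.
  by module_eq u w w; field; lra.
apply: (@coneP _ _ _ coneK _ _ (l1 + l2)^-1 (l2 / (l1 + l2)) _ h1 Ku) => //.
  by apply: divr_ge0; lra.
by module_eq u w w; field; lra.
Qed.

Lemma ou_interiorP z :
  ou_interior K u z <-> exists2 e : R, 0 < e & K (z - e *: u).
Proof.
case: (hKu) => _ _ [Ku hu]; split => [[e e0 he]|[e e0 Kze]].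
  have e2 : 0 < e / 2 by lra.
  exists (e / 2) => //; apply: he.
  rewrite addrAC subrr add0r; apply: (@le_lt_trans _ _ (e / 2)); last by lra.
  apply: ge_inf; first by exists 0 => l [l0 _ _]; apply: ltW.
  split => //; rewrite /cone_le.
    by apply: (@coneP _ _ _ coneK _ _ 0 0 _ Ku Ku) => //; module_eq u u u; ring.
  by apply: (@coneP _ _ _ coneK _ _ e 0 _ Ku Ku); rewrite ?lexx ?ltW //;
    module_eq u u u; field.
exists e => // w; rewrite /ou_norm => hlt.
set E := (X in inf X) in hlt.
have hE : has_inf E.
  split; last by exists 0 => l [l0 _ _]; apply: ltW.
  have [l1 l10 h1] := hu (w - z); have [l2 l20 h2] := hu (- (w - z)).
  exists (l1 + l2); split; first lra.
    apply: (@coneP _ _ _ coneK _ _ 1 l1 _ h2 Ku); rewrite ?ler01 ?ltW //.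
    by module_eq u w z; ring.
  apply: (@coneP _ _ _ coneK _ _ 1 l2 _ h1 Ku); rewrite ?ler01 ?ltW //.
  by module_eq u w z; ring.
have d0 : 0 < e - inf E by rewrite subr_gt0.
have [l [l0 hl _]] := inf_adherent d0 hE.
rewrite addrC subrK => le.
have K1 : K (w - z + e *: u).
  apply: (@coneP _ _ _ coneK _ _ 1 (e - l) _ hl Ku) => //; first lra.
  by module_eq u w z; ring.
apply: (@coneP _ _ _ coneK _ _ 1 1 _ K1 Kze) => //.
by module_eq u w z; ring.
Qed.

Lemma interior_cone z : ou_interior K u z -> K z.
Proof.
move=> /ou_interiorP[e e0 Kze]; case: (hKu) => _ _ [Ku _].
apply: (@coneP _ _ _ coneK _ _ 1 e _ Kze Ku); rewrite ?ltW //.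
by module_eq z u u; ring.
Qed.

Lemma interior_mono z w k : 0 < k -> ou_interior K u z -> K (w - k *: z) ->
  ou_interior K u w.
Proof.
move=> k0 /ou_interiorP[e e0 Kze] Kwz; apply/ou_interiorP.
exists (k * e); first exact: mulr_gt0.
apply: (@coneP _ _ _ coneK _ _ 1 k _ Kwz Kze); rewrite ?ltW //.
by module_eq z w u; ring.
Qed.

Lemma feasible_interior z : ou_interior K u z -> feasible K z = setT.
Proof.
move=> /ou_interiorP[e e0 Kze]; apply/seteqP; split => // w _.
exact: (feasible_mono coneK e0 Kze (feasible_unit w)).
Qed.

Lemma interior_dominates x y : ou_interior K u y ->
  exists2 l : R, 0 < l & K (l *: y - x).
Proof.
move=> /feasible_interior fy; have [e e0 [_ h]] : feasible K y x by rewrite fy.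
exists e^-1; first by rewrite invr_gt0.
apply: (@coneP _ _ _ coneK _ _ e^-1 0 _ h h); rewrite ?lexx ?invr_ge0 ?ltW //.
by module_eq x y y; field; rewrite gt_eqF.
Qed.

(** The Archimedean property makes the infimum defining [M(x/y)] a minimum. *)
Lemma MratioP x y : ~ K (- x) -> ou_interior K u y ->
  [/\ 0 < Mratio K x y, K (Mratio K x y *: y - x)
    & forall b, K (b *: y - x) -> Mratio K x y <= b].
Proof.
move=> nKx yi; have Ky := interior_cone yi; rewrite /Mratio.
set E := [set b : R | _].
have posb b : K (b *: y - x) -> 0 < b.
  move=> Kb; rewrite ltNge; apply/negP => b0; apply: nKx.
  apply: (@coneP _ _ _ coneK _ _ 1 (- b) _ Kb Ky) => //; first lra.
  by module_eq x y y; ring.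
have hE : has_inf E.
  split; last by exists 0 => l [l0 _]; apply: ltW.
  by have [l l0 h] := interior_dominates x yi; exists l.
have Kinf : K (inf E *: y - x).
  have arch : archimedean K by case: hKu.
  (* [n (x - M y) <= y] follows from [x <= b y] with [b] within [1/n] of [M] *)
  have := arch (x - inf E *: y) y Ky; rewrite /cone_le sub0r opprB; apply.
  move=> n n1; have n0 : 0 < n%:R :> R by rewrite ltr0n.
  have [b [b0 hb]] : exists2 b, E b & b < inf E + n%:R^-1.
    by apply: inf_adherent => //; rewrite invr_gt0.
  rewrite -(ltr_pM2l n0) mulrDr divff ?gt_eqF // => lt.
  rewrite -scaler_nat.
  apply: (@coneP _ _ _ coneK _ _ n%:R (1 + n%:R * inf E - n%:R * b) _ hb Ky).
  - exact: ltW.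
  - lra.
  - by module_eq x y y; ring.
split => //; first exact: posb.
by move=> b Kb; apply: ge_inf; [case: hE | split => //; exact: posb].
Qed.

End OrderUnit.

(** * The canonical midpoint in coordinates *)

Section CanonicalMidpoint.
Variables (R : realType) (V : lmodType R) (K : set V).
Implicit Types (p q v x y : V).

Lemma lin_span2 x y :
  lin_span [set x; y] = [set v | exists s t : R, v = s *: x + t *: y].
Proof.
apply/seteqP; split => v.
  move=> [n [a [w [ww ->]]]].
  elim/big_ind : _ => [|_ _ [s [t ->]] [s' [t' ->]]|i _].
  - by exists 0, 0; module_eq x y y; ring.
  - by exists (s + s'), (t + t'); module_eq x y y; ring.
  - by case: (ww i) => ->; [exists (a i), 0|exists 0, (a i)];
      module_eq x y y; ring.
move=> [s [t ->]]; exists 2%N, (fun i => if i == ord0 then s else t).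
exists (fun i => if i == ord0 then x else y); split.
  by move=> i; case: ifP => _; [left|right].
by rewrite big_ord_recl big_ord1.
Qed.

Lemma linear_on_comb (W : set V) (psi : V -> R) p q s t :
  linear_on W psi -> W 0 -> W p -> W q -> W (t *: q) ->
  psi (s *: p + t *: q) = s * psi p + t * psi q.
Proof.
move=> lin W0 Wp Wq Wtq; rewrite lin //; congr (_ + _).
have psi0 : psi 0 = 0.
  by have := lin (-1) 0 0 W0 W0; rewrite scaleN1r oppr0 addr0 mulN1r addNr.
by have := lin t q 0 Wq W0; rewrite addr0 psi0 addr0.
Qed.

Lemma powR_half (a b : R) : 0 <= a -> 0 <= b ->
  a `^ (1 - 2^-1) * b `^ 2^-1 = Num.sqrt (a * b).
Proof.
move=> a0 b0; rewrite (_ : 1 - 2^-1 = 2^-1 :> R); last by field.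
by rewrite !powR12_sqrt // sqrtrM.
Qed.

(** The geometric mean is homogeneous, so the scaling of a functional cancels
    in the equation that defines the canonical midpoint. *)
Lemma powR_half_scale (k a b t : R) : 0 < k -> 0 <= a -> 0 <= b ->
  t * k = (a * k) `^ (1 - 2^-1) * (b * k) `^ 2^-1 -> t = Num.sqrt (a * b).
Proof.
move=> k0 a0 b0; rewrite powR_half ?mulr_ge0 ?(ltW k0) // mulrACA.
rewrite sqrtrM ?mulr_ge0 // -expr2 sqrtr_sqr (gtr0_norm k0).
by move=> /mulIf; apply; rewrite gt_eqF.
Qed.

(** The uniqueness of the functionals describing a planar cone, up to exchange
    and positive scaling, in coordinates along its extremal rays. *)
Lemma quadrant_functionals (a1 b1 a2 b2 : R) :
  (forall s t : R, 0 <= s /\ 0 <= t <->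
     0 <= s * a1 + t * b1 /\ 0 <= s * a2 + t * b2) ->
  (a1 = 0 \/ a2 = 0) /\ (b1 = 0 \/ b2 = 0) /\
  [/\ 0 <= a1, 0 <= b1, 0 <= a2 & 0 <= b2].
Proof.
move=> H.
have [] := (H 1 0).1 (conj ler01 (lexx 0)).
rewrite !mul1r !mul0r !addr0 => a10 a20.
have [] := (H 0 1).1 (conj (lexx 0) ler01).
rewrite !mul1r !mul0r !add0r => b10 b20.
have D0 : 0 < a1 * b2 + a2 * b1 + 1.
  by have := mulr_ge0 a10 b20; have := mulr_ge0 a20 b10; lra.
have Di : 0 < (a1 * b2 + a2 * b1 + 1)^-1 by rewrite invr_gt0.
set D := (a1 * b2 + a2 * b1 + 1) in D0 Di *.
(* A pair with one coordinate slightly negative would satisfy both inequalities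
   if neither functional vanished on the other axis. *)
have neg (c c' d d' : R) : 0 <= c -> 0 <= c' -> 0 <= d -> 0 <= d' ->
    c * d' + c' * d + 1 = D -> 0 <= c - c * c' / D * d.
  move=> c0 c'0 d0 d'0 eD; rewrite (_ : _ - _ = c * (c * d' + 1) / D).
    apply: divr_ge0; last exact: ltW.
    by apply: mulr_ge0 => //; apply: addr_ge0 => //; apply: mulr_ge0.
  by have := lt0r_neq0 D0; rewrite -eD => D1; field.
split; [|split; last by []].
  have [->|a1n] := eqVneq a1 0; [by left|right].
  have [->//|a2n] := eqVneq a2 0.
  have h1 : 0 <= 1 * a1 + - (a1 * a2 / D) * b1.
    by rewrite mul1r mulNr; apply: (neg _ _ _ b2).
  have h2 : 0 <= 1 * a2 + - (a1 * a2 / D) * b2.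
    rewrite mul1r mulNr (mulrC a1); apply: (neg _ _ _ b1) => //.
    by rewrite /D; ring.
  have [_] := (H 1 (- (a1 * a2 / D))).2 (conj h1 h2).
  by rewrite oppr_ge0 leNgt !mulr_gt0 // lt0r ?a1n ?a2n.
have [->|b1n] := eqVneq b1 0; [by left|right].
have [->//|b2n] := eqVneq b2 0.
have h1 : 0 <= - (b1 * b2 / D) * a1 + 1 * b1.
  rewrite mul1r mulNr addrC; apply: (neg _ _ _ a2) => //.
  by rewrite /D; ring.
have h2 : 0 <= - (b1 * b2 / D) * a2 + 1 * b2.
  rewrite mul1r mulNr addrC (mulrC b1); apply: (neg _ _ _ a1) => //.
  by rewrite /D; ring.
have [] := (H (- (b1 * b2 / D)) 1).2 (conj h1 h2).
by rewrite oppr_ge0 leNgt !mulr_gt0 // lt0r ?b1n ?b2n.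
Qed.

(** In the coordinates along the two extremal rays of the planar cone, the
    canonical midpoint is the coordinatewise geometric mean. Any pair of
    functionals describing the planar cone consists of positive multiples of
    these coordinates, and such multiples do not change the geometric mean. *)
Lemma canonical_midpointE x y p q (x1 x2 y1 y2 : R) :
  lin_indep2 p q -> lin_span [set x; y] = lin_span [set p; q] ->
  (forall s t : R, K (s *: p + t *: q) <-> 0 <= s /\ 0 <= t) ->
  x = x1 *: p + x2 *: q -> y = y1 *: p + y2 *: q ->
  0 <= x1 -> 0 <= x2 -> 0 <= y1 -> 0 <= y2 ->
  canonical_midpoint K x y =
    Num.sqrt (x1 * y1) *: p + Num.sqrt (x2 * y2) *: q.
Proof.
move=> pq Wpq Kpq ex ey x10 x20 y10 y20.
set W := lin_span [set x; y].
have WP v : W v <-> exists s t : R, v = s *: p + t *: q.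
  by rewrite /W Wpq lin_span2.
have Wc s t : W (s *: p + t *: q) by apply/WP; exists s, t.
have uniq s t s' t' : s *: p + t *: q = s' *: p + t' *: q -> s = s' /\ t = t'.
  move=> e; have [] := pq (s - s') (t - t').
    rewrite (_ : _ + _ = s *: p + t *: q - (s' *: p + t' *: q)).
      by rewrite e subrr.
    by module_eq p q q; ring.
  by move=> /eqP; rewrite subr_eq0 => /eqP -> /eqP; rewrite subr_eq0 => /eqP ->.
apply: xget_unique.
  (* the coordinates along [p] and [q], arbitrary off the plane *)
  pose f1 v := xget 0 [set s : R | exists t, v = s *: p + t *: q].
  pose f2 v := xget 0 [set t : R | exists s, v = s *: p + t *: q].
  have f1E s t : f1 (s *: p + t *: q) = s.
    apply: xget_unique; first by exists t.
    by move=> s' [t' /uniq[]].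
  have f2E s t : f2 (s *: p + t *: q) = t.
    apply: xget_unique; first by exists s.
    by move=> t' [s' /uniq[]].
  have linf a s t s' t' : a *: (s *: p + t *: q) + (s' *: p + t' *: q)
      = (a * s + s') *: p + (a * t + t') *: q by module_eq p q q; ring.
  exists f1, f2; split; [split| | |].
  - by move=> a v w /WP[s [t ->]] /WP[s' [t' ->]]; rewrite linf !f1E.
  - by move=> a v w /WP[s [t ->]] /WP[s' [t' ->]]; rewrite linf !f2E.
  - move=> a b ab; split.
      by have := ab _ (Wc 1 0); rewrite f1E f2E mulr1 mulr0 addr0.
    by have := ab _ (Wc 0 1); rewrite f1E f2E mulr1 mulr0 add0r.
  - apply/seteqP; split => v.
      move=> [Wv Kv]; have /WP[s [t ev]] := Wv; move: Wv Kv.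
      by rewrite /= ev f1E f2E => Wv /Kpq[].
    move=> [Wv]; have /WP[s [t ev]] := Wv; move: Wv.
    by rewrite /= ev f1E f2E => Wv s0 t0; split => //; apply/Kpq.
  - exact: Wc.
  - by rewrite ex ey !f1E powR_half.
  - by rewrite ex ey !f2E powR_half.
move=> g [f1 [f2 [[lin1 lin2 ind cut] /WP[s [t ->]] g1 g2]]].
have W0 : W 0 by rewrite -(addr0 0) -[X in X + _](scale0r p) -(scale0r q).
have Wp : W p by rewrite -(addr0 p) -(scale0r q) -[X in X + _]scale1r.
have Wq : W q by rewrite -(add0r q) -(scale0r p) -[X in _ + X]scale1r.
have Wt c : W (c *: q) by rewrite -(add0r (c *: q)) -(scale0r p).
have f1E a b : f1 (a *: p + b *: q) = a * f1 p + b * f1 q.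
  exact: (linear_on_comb _ lin1 W0 Wp Wq (Wt b)).
have f2E a b : f2 (a *: p + b *: q) = a * f2 p + b * f2 q.
  exact: (linear_on_comb _ lin2 W0 Wp Wq (Wt b)).
have H a b : 0 <= a /\ 0 <= b <->
    0 <= a * f1 p + b * f1 q /\ 0 <= a * f2 p + b * f2 q.
  rewrite -f1E -f2E -Kpq; split => [Kab|[h1 h2]].
    by have : (W `&` K) (a *: p + b *: q) by []; rewrite cut => -[].
  have WK : (W `&` K) (a *: p + b *: q) by rewrite cut; split => //; apply: Wc.
  by case: WK.
have [Ha [Hb [p10 q10 p20 q20]]] := quadrant_functionals H.
have nz1 : ~ (f1 p = 0 /\ f1 q = 0).
  move=> [h1 h2]; have [] := ind 1 0; last by move=> /eqP; rewrite oner_eq0.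
  by move=> v /WP[a [b ->]]; rewrite f1E h1 h2; ring.
have nz2 : ~ (f2 p = 0 /\ f2 q = 0).
  move=> [h1 h2]; have [|_ /eqP] := ind 0 1; last by rewrite oner_eq0.
  by move=> v /WP[a [b ->]]; rewrite f2E h1 h2; ring.
move: g1 g2; rewrite ex ey !f1E !f2E.
have pos (c : R) : 0 <= c -> c <> 0 -> 0 < c.
  by move=> c0 /eqP cn; rewrite lt0r cn.
case: Ha => hp; case: Hb => hq.
- by exfalso; apply: nz1.
- rewrite hp hq !mulr0 !add0r !addr0 => g1 g2.
  have k1 : 0 < f1 q by apply: pos => // h; apply: nz1.
  have k2 : 0 < f2 p by apply: pos => // h; apply: nz2.
  by rewrite -(powR_half_scale k1 x20 y20 g1) -(powR_half_scale k2 x10 y10 g2).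
- rewrite hp hq !mulr0 !add0r !addr0 => g1 g2.
  have k1 : 0 < f1 p by apply: pos => // h; apply: nz1.
  have k2 : 0 < f2 q by apply: pos => // h; apply: nz2.
  by rewrite -(powR_half_scale k1 x10 y10 g1) -(powR_half_scale k2 x20 y20 g2).
- by exfalso; apply: nz2.
Qed.

End CanonicalMidpoint.

(** * Midpoints of the Thompson metric *)

Section Midpoints.
Variables (R : realType) (V : lmodType R) (K : set V) (u : V).
Hypothesis hKu : order_unit_space K u.
Implicit Types (w x y z : V).

Let coneK : cone K. Proof. by case: hKu. Qed.

(** Keeps the ratios [M(z/_)] positive. The nonzero vector [x] excludes the
    trivial space, where [0] is an interior point. *)
Lemma interior_notN x z : x <> 0 -> ou_interior K u z -> ~ K (- z).
Proof.
move=> x0 zi KNz; have z0 := cone_pointed coneK (interior_cone hKu zi) KNz.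
have [e e0 [h1 h2]] : feasible K z x by rewrite (feasible_interior hKu zi).
move: h1 h2; rewrite z0 add0r sub0r => h1 h2.
have /eqP := cone_pointed coneK h1 h2.
by rewrite scaler_eq0 gt_eqF //= => /eqP.
Qed.

Lemma cone_chain x y z (k l : R) : 0 <= k -> K (k *: z - x) -> K (l *: y - z) ->
  K ((k * l) *: y - x).
Proof.
move=> k0 h1 h2; apply: (coneP coneK h1 h2 ler01 k0).
by module_eq x y z; ring.
Qed.

Lemma le_coneW x y (k l : R) : K y -> k <= l -> K (k *: y - x) ->
  K (l *: y - x).
Proof.
move=> Ky kl h; apply: (@coneP _ _ _ coneK _ _ 1 (l - k) _ h Ky) => //.
  by rewrite subr_ge0.
by module_eq x y y; ring.
Qed.

Lemma thompsonC x y : thompson K x y = thompson K y x.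
Proof. by rewrite /thompson maxC. Qed.

Lemma midpointsC x y : midpoints K u x y = midpoints K u y x.
Proof.
by apply/seteqP; split => z [zi h1 h2]; split => //;
  rewrite thompsonC [thompson _ _ _ in RHS]thompsonC.
Qed.

(** Write [r ^+ 2] for the larger ratio. A midpoint satisfies [x <= r z],
    [z <= r y], and the same with [x] and [y] exchanged; conversely, as
    [M(x/y) <= M(x/z) M(z/y)], neither factor can be smaller than [r]. *)
Lemma midpointsP x y z (r : R) : x <> 0 ->
  ou_interior K u x -> ou_interior K u y ->
  0 < r -> r ^+ 2 = Mratio K x y -> Mratio K y x <= Mratio K x y ->
  midpoints K u x y z <->
  [/\ K (r *: z - x), K (r *: y - z), K (r *: z - y) & K (r *: x - z)].
Proof.
move=> x0 xi yi r0 r2 Mle.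
have nK v : ou_interior K u v -> ~ K (- v) by exact: interior_notN x0.
have [Kx Ky] := (interior_cone hKu xi, interior_cone hKu yi).
have [Mxy0 Kxy minxy] := MratioP hKu (nK _ xi) yi.
have [Myx0 Kyx minyx] := MratioP hKu (nK _ yi) xi.
have half : 2^-1 * thompson K x y = ln r.
  rewrite /thompson max_l // -r2 lnXn // -[ln r *+ 2]mulr_natl.
  by rewrite mulrA mulVf ?mul1r.
rewrite /midpoints /= half; split.
  move=> [zi e1 e2]; have Kz := interior_cone hKu zi.
  have [Mxz0 Kxz _] := MratioP hKu (nK _ xi) zi.
  have [Mzx0 Kzx _] := MratioP hKu (nK _ zi) xi.
  have [Mzy0 Kzy _] := MratioP hKu (nK _ zi) yi.
  have [Myz0 Kyz _] := MratioP hKu (nK _ yi) zi.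
  have m1 : Num.max (Mratio K x z) (Mratio K z x) = r.
    by apply: ln_inj e1; rewrite ?posrE // lt_max Mxz0.
  have m2 : Num.max (Mratio K z y) (Mratio K y z) = r.
    by apply: ln_inj e2; rewrite ?posrE // lt_max Mzy0.
  split.
  - by apply: le_coneW Kxz => //; rewrite -m1 le_max lexx.
  - by apply: le_coneW Kzy => //; rewrite -m2 le_max lexx.
  - by apply: le_coneW Kyz => //; rewrite -m2 le_max lexx orbT.
  - by apply: le_coneW Kzx => //; rewrite -m1 le_max lexx orbT.
move=> [h1 h2 h3 h4].
have zi : ou_interior K u z.
  apply: (interior_mono hKu (k := r^-1) _ xi); first by rewrite invr_gt0.
  apply: (@coneP _ _ _ coneK _ _ r^-1 0 _ h1 h1) => //.
    by rewrite invr_ge0 ltW.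
  by module_eq x z z; field; rewrite gt_eqF.
have [Mxz0 Kxz minxz] := MratioP hKu (nK _ xi) zi.
have [Mzx0 Kzx minzx] := MratioP hKu (nK _ zi) xi.
have [Mzy0 Kzy minzy] := MratioP hKu (nK _ zi) yi.
have [Myz0 Kyz minyz] := MratioP hKu (nK _ yi) zi.
have lxz := minxz _ h1; have lzx := minzx _ h4.
have lzy := minzy _ h2; have lyz := minyz _ h3.
have prod : r ^+ 2 <= Mratio K x z * Mratio K z y.
  by rewrite r2; apply: minxy; apply: cone_chain Kxz Kzy; apply: ltW.
have exz : Mratio K x z = r.
  apply/eqP; rewrite eq_le lxz /= -(ler_pM2r r0) -expr2 (le_trans prod) //.
  by rewrite ler_pM2l.
have ezy : Mratio K z y = r.
  apply/eqP; rewrite eq_le lzy /= -(ler_pM2l r0) -expr2 (le_trans prod) //.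
  by rewrite ler_pM2r.
by split => //; rewrite /thompson max_l ?exz ?ezy.
Qed.

Lemma cone_scaleE k v : 0 < k -> K (k *: v) <-> K v.
Proof.
move=> k0; split; last by apply: coneZ => //; apply: ltW.
move=> /(coneZ coneK (l := k^-1)); rewrite scalerA mulVf ?gt_eqF // scale1r.
by apply; rewrite invr_ge0 ltW.
Qed.

(** * The planar cone of two independent interior points *)

Section Plane.
Variables x y : V.
Hypotheses (xi : ou_interior K u x) (yi : ou_interior K u y).
Hypothesis xy : lin_indep2 x y.

Let Mxy := Mratio K x y.
Let Myx := Mratio K y x.
Let p := Mxy *: y - x.
Let q := Myx *: x - y.

Let x0 : x <> 0.
Proof.
move=> x0; have [] := xy (a := 1) (b := 0).
  by rewrite x0 scaler0 scale0r addr0.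
by move=> /eqP; rewrite oner_eq0.
Qed.

Lemma Mratio_gt0 : 0 < Mxy /\ 0 < Myx.
Proof.
have [h1 _ _] := MratioP hKu (interior_notN x0 xi) yi.
by have [h2 _ _] := MratioP hKu (interior_notN x0 yi) xi.
Qed.

Lemma extremal_rays : K p /\ K q.
Proof.
have [_ h1 _] := MratioP hKu (interior_notN x0 xi) yi.
by have [_ h2 _] := MratioP hKu (interior_notN x0 yi) xi.
Qed.

Lemma Mratio_prod_gt1 : 1 < Mxy * Myx.
Proof.
have [a0 b0] := Mratio_gt0; have [Kp Kq] := extremal_rays.
rewrite ltNge; apply/negP => ab1.
(* the reverse of [y <= M(y/x) x] holds as well, so [y] is a multiple of [x] *)
have K1 : K (- q).
  have Ky := interior_cone hKu yi.
  apply: (@coneP _ _ _ coneK _ _ Myx (1 - Mxy * Myx) _ Kp Ky).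
  - exact: ltW.
  - by rewrite subr_ge0.
  - by rewrite /p /q; module_eq x y y; ring.
have := cone_pointed coneK Kq K1; rewrite /q -scaleN1r => /xy[_ /eqP].
by rewrite oppr_eq0 oner_eq0.
Qed.

(** A point of [K] in the plane beyond the ray of [p] or of [q] would violate
    the minimality of [M(x/y)] or of [M(y/x)]. *)
Lemma planar_coneP (s t : R) : K (s *: p + t *: q) <-> 0 <= s /\ 0 <= t.
Proof.
have [a0 b0] := Mratio_gt0; have [Kp Kq] := extremal_rays.
have ab := Mratio_prod_gt1.
have [_ _ minxy] := MratioP hKu (interior_notN x0 xi) yi.
have [_ _ minyx] := MratioP hKu (interior_notN x0 yi) xi.
split; last first.
  by move=> [s0 t0]; apply: (coneP coneK Kp Kq s0 t0).
move=> Kst; split; rewrite leNgt; apply/negP => lt0.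
  (* enlarging [t] to [k > 0] keeps the point in [K]; the resulting bound on
     [y] by a multiple of [x] beats [M(y/x)] *)
- set k := Num.max t 1.
  have k0 : 0 < k by rewrite lt_max ltr01 orbT.
  have Kk : K (s *: p + k *: q).
    apply: (@coneP _ _ _ coneK _ _ 1 (k - t) _ Kst Kq) => //.
      by rewrite subr_ge0 le_max lexx.
    by module_eq p q q; ring.
  have D0 : 0 < k - s * Mxy.
    by rewrite subr_gt0 (lt_trans _ k0) // nmulr_rlt0.
  have /minyx : K (((k * Myx - s) / (k - s * Mxy)) *: x - y).
    apply: (@coneP _ _ _ coneK _ _ (k - s * Mxy)^-1 0 _ Kk Kk) => //.
      by rewrite invr_ge0 ltW.
    by rewrite /p /q; module_eq x y y; field; rewrite gt_eqF.
  rewrite ler_pdivlMr // leNgt => /negP; apply.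
  rewrite -subr_gt0 (_ : _ - _ = (- s) * (Mxy * Myx - 1));
    last by rewrite -/Myx; ring.
  by rewrite mulr_gt0 ?oppr_gt0 ?subr_gt0.
- set k := Num.max s 1.
  have k0 : 0 < k by rewrite lt_max ltr01 orbT.
  have Kk : K (k *: p + t *: q).
    apply: (@coneP _ _ _ coneK _ _ 1 (k - s) _ Kst Kp) => //.
      by rewrite subr_ge0 le_max lexx.
    by module_eq p q q; ring.
  have D0 : 0 < k - t * Myx.
    by rewrite subr_gt0 (lt_trans _ k0) // nmulr_rlt0.
  have /minxy : K (((k * Mxy - t) / (k - t * Myx)) *: y - x).
    apply: (@coneP _ _ _ coneK _ _ (k - t * Myx)^-1 0 _ Kk Kk) => //.
      by rewrite invr_ge0 ltW.
    by rewrite /p /q; module_eq x y y; field; rewrite gt_eqF.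
  rewrite ler_pdivlMr // leNgt => /negP; apply.
  rewrite -subr_gt0 (_ : _ - _ = (- t) * (Mxy * Myx - 1));
    last by rewrite -/Mxy; ring.
  by rewrite mulr_gt0 ?oppr_gt0 ?subr_gt0.
Qed.

Variables r s : R.
Hypotheses (r0 : 0 < r) (s0 : 0 < s) (r2 : r ^+ 2 = Mxy) (s2 : s ^+ 2 = Myx).

Lemma canonical_midpoint_comb :
  canonical_midpoint K x y = (r * s + 1)^-1 *: (s *: x + r *: y).
Proof.
have [a0 b0] := Mratio_gt0; have ab := Mratio_prod_gt1.
have D0 : 0 < Mxy * Myx - 1 by rewrite subr_gt0.
have Dn : Mxy * Myx - 1 != 0 by rewrite gt_eqF.
set D := Mxy * Myx - 1 in D0 Dn.
have ex : x = D^-1 *: p + (Mxy / D) *: q.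
  by rewrite /p /q /D; module_eq x y y; field.
have ey : y = (Myx / D) *: p + D^-1 *: q.
  by rewrite /p /q /D; module_eq x y y; field.
have pq : lin_indep2 p q.
  move=> c d; rewrite (_ : _ + _ = (d * Myx - c) *: x + (c * Mxy - d) *: y).
    move=> /xy[h1 h2].
    have ec : c = d * Myx by apply/esym/eqP; rewrite -subr_eq0 h1.
    have : d * D = 0 by rewrite -h2 ec /D; ring.
    move=> /eqP; rewrite mulf_eq0 (negPf Dn) orbF => /eqP ed.
    by rewrite ec ed mul0r.
  by rewrite /p /q; module_eq x y y; ring.
have spans : lin_span [set x; y] = lin_span [set p; q].
  rewrite !lin_span2; apply/seteqP; split => v [c [d ->]].
    exists (c * D^-1 + d * (Myx / D)), (c * (Mxy / D) + d * D^-1).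
    by rewrite {1}ex {1}ey; module_eq p q q; field.
  exists (d * Myx - c), (c * Mxy - d).
  by rewrite /p /q; module_eq x y y; ring.
have Di : 0 <= D^-1 by rewrite invr_ge0 ltW.
have cx : 0 <= Mxy / D by rewrite mulr_ge0 // ltW.
have cy : 0 <= Myx / D by rewrite mulr_ge0 // ltW.
rewrite (canonical_midpointE pq spans planar_coneP ex ey) //.
have e1 : Num.sqrt (D^-1 * (Myx / D)) = s / D.
  rewrite (_ : D^-1 * (Myx / D) = (s / D) ^+ 2); last by rewrite -s2; field.
  by rewrite sqrtr_sqr ger0_norm // divr_ge0 ?ltW.
have e2 : Num.sqrt (Mxy / D * D^-1) = r / D.
  rewrite (_ : Mxy / D * D^-1 = (r / D) ^+ 2); last by rewrite -r2; field.
  by rewrite sqrtr_sqr ger0_norm // divr_ge0 ?ltW.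
have Dn' : (r * s) ^+ 2 - 1 != 0 by rewrite exprMn r2 s2.
have rs1 : r * s + 1 != 0 by rewrite gt_eqF // addr_gt0 ?mulr_gt0.
rewrite e1 e2 /p /q /D -r2 -s2.
by module_eq x y y; field; rewrite rs1 Dn'.
Qed.

Let m := canonical_midpoint K x y.

(** At [m] the bounds [r^-1 x <= z <= r y] have slacks proportional to [p]. The
    bounds [r^-1 y <= z <= r x] have slacks proportional to [q], up to adding a
    multiple of an interior point that vanishes exactly when [r = s]; when it
    does not vanish these slacks are interior and restrict no direction. *)
Lemma aff_span_midpoints : Myx <= Mxy ->
  aff_span (midpoints K u x y) =
  translate m (feasible K p `&` (if s < r then setT else feasible K q)).
Proof.
move=> Mle; have [Kp Kq] := extremal_rays.
have rs1 : 0 < r * s + 1 by rewrite addr_gt0 ?mulr_gt0.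
have [rn sn rsn] : [/\ r != 0, s != 0 & r * s + 1 != 0] by rewrite !gt_eqF.
have em := canonical_midpoint_comb; rewrite -/m in em.
have sr : s <= r.
  by rewrite -(ler_pXn2r (n := 2)) ?nnegrE ?(ltW r0) ?(ltW s0) // r2 s2.
set k1 := (r * (r * s + 1))^-1; set k2 := s / (r * s + 1).
set k3 := (s * (r * s + 1))^-1; set k4 := r / (r * s + 1).
have k10 : 0 < k1 by rewrite invr_gt0 mulr_gt0.
have k20 : 0 < k2 by rewrite divr_gt0.
have k30 : 0 < k3 by rewrite invr_gt0 mulr_gt0.
have k40 : 0 < k4 by rewrite divr_gt0.
have ec1 : m - r^-1 *: x = k1 *: p.
  by rewrite em /p -r2 /k1; module_eq x y y; field; rewrite ?rn ?rsn.
have ec2 : r *: y - m = k2 *: p.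
  by rewrite em /p -r2 /k2; module_eq x y y; field; rewrite ?rn ?rsn.
pose g := (r - s) / (r * s).
have ed1 : m - r^-1 *: y = k3 *: q + g *: y.
  by rewrite em /q -s2 /k3 /g; module_eq x y y; field; rewrite ?rn ?sn ?rsn.
have ed2 : r *: x - m = k4 *: q + (r - s) *: x.
  by rewrite em /q -s2 /k4; module_eq x y y; field; rewrite ?rn ?sn ?rsn.
have g0 : 0 <= g by rewrite divr_ge0 ?subr_ge0 // ltW // mulr_gt0.
set F := if s < r then setT else feasible K q.
have [fd1 fd2] : feasible K (m - r^-1 *: y) = F /\ feasible K (r *: x - m) = F.
  rewrite /F; case: ifPn => [lt|]; last first.
    rewrite -leNgt => rs'; have ers : r = s by apply/eqP; rewrite eq_le rs' sr.
    rewrite ed1 ed2 /g ers subrr mul0r !scale0r !addr0.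
    by rewrite !feasible_scale.
  have gp : 0 < g by rewrite divr_gt0 ?subr_gt0 ?mulr_gt0.
  split; apply: (feasible_interior hKu).
    apply: (interior_mono hKu gp yi); rewrite ed1 addrK.
    by apply: coneZ => //; apply: ltW.
  apply: (@interior_mono _ _ _ _ hKu _ _ (r - s) _ xi); rewrite ?subr_gt0 //.
  by rewrite ed2 addrK; apply: coneZ => //; apply: ltW.
rewrite (aff_span_box coneK (m := m) (c1 := m - r^-1 *: x) (c2 := r *: y - m)
  (d1 := m - r^-1 *: y) (d2 := r *: x - m)).
- by rewrite fd1 ec1 feasible_scale.
- by rewrite ec1; apply: coneZ => //; apply: ltW.
- by rewrite ec2; apply: coneZ => //; apply: ltW.
- by rewrite ed1; apply: (coneP coneK Kq (interior_cone hKu yi) (ltW k30) g0).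
- rewrite ed2; apply: (coneP coneK Kq (interior_cone hKu xi) (ltW k40) _ erefl).
  by rewrite subr_ge0.
- by rewrite ec1 ec2 !feasible_scale.
- by rewrite fd1 fd2.
- move=> w; rewrite (midpointsP (m + w) x0 xi yi r0 r2 Mle).
  have lowerE z : r *: (m + w) - z = r *: (m - r^-1 *: z + w).
    by module_eq m w z; field.
  have upperE z : r *: z - (m + w) = r *: z - m - w by module_eq m w z; ring.
  rewrite !lowerE !upperE.
  by split => -[h1 h2 h3 h4]; split => //; apply/(cone_scaleE _ r0).
Qed.

Lemma endpointE : 1 < Mxy -> endpoint K x y = (Mxy - 1)^-1 *: p.
Proof.
move=> M1; rewrite /endpoint /p -/Mxy.
have h1 : Mxy - 1 != 0 by rewrite gt_eqF // subr_gt0.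
have h2 : 1 - Mxy != 0 by rewrite lt_eqF // subr_lt0.
by module_eq x y y; field; rewrite ?h1 ?h2.
Qed.

Lemma lin_span_face_endpoint : 1 < Mxy ->
  lin_span (face K (endpoint K x y)) = feasible K p.
Proof.
have [Kp _] := extremal_rays.
move=> M1; have k0 : 0 < (Mxy - 1)^-1 by rewrite invr_gt0 subr_gt0.
rewrite endpointE // lin_span_face // ?feasible_scale //.
by apply: coneZ => //; apply: ltW.
Qed.

End Plane.
End Midpoints.

Theorem theorem3p2 (R : realType) (V : lmodType R) (K : set V) (u x y : V)
  (hKu : order_unit_space K u)
  (hx : ou_interior K u x) (hy : ou_interior K u y)
  (hxy : lin_indep2 x y) :
  let m := canonical_midpoint K x y in
  let y' := endpoint K x y in
  let x' := endpoint K y x in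
  [/\ Mratio K x y > Mratio K y x ->
        aff_span (midpoints K u x y) = translate m (lin_span (face K y')),
      Mratio K y x > Mratio K x y ->
        aff_span (midpoints K u x y) = translate m (lin_span (face K x'))
    & Mratio K x y = Mratio K y x ->
        aff_span (midpoints K u x y) =
        translate m (lin_span (face K x') `&` lin_span (face K y'))].
Proof.
move=> m y' x'.
have yx : lin_indep2 y x by move=> b a; rewrite addrC => /hxy[-> ->].
have [a0 b0] := Mratio_gt0 hKu hx hy hxy.
have ab := Mratio_prod_gt1 hKu hx hy hxy.
pose r := Num.sqrt (Mratio K x y); pose s := Num.sqrt (Mratio K y x).
have r2 : r ^+ 2 = Mratio K x y by rewrite sqr_sqrtr // ltW.
have s2 : s ^+ 2 = Mratio K y x by rewrite sqr_sqrtr // ltW.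
have r0 : 0 < r by rewrite sqrtr_gt0.
have s0 : 0 < s by rewrite sqrtr_gt0.
have gt1 (a b : R) : 0 < a -> 0 < b -> b <= a -> 1 < a * b -> 1 < a.
  move=> ap bp ba; rewrite !ltNge; apply: contra => a1.
  exact: mulr_ile1 (ltW ap) (ltW bp) a1 (le_trans ba a1).
split=> [lt|lt|eqM].
- rewrite (aff_span_midpoints hKu hx hy hxy r0 s0 r2 s2 (ltW lt)).
  rewrite ltr_sqrt // lt setIT (lin_span_face_endpoint hKu hx hy hxy) //.
  exact: gt1 a0 b0 (ltW lt) ab.
- have ba : 1 < Mratio K y x * Mratio K x y by rewrite mulrC.
  have -> : m = canonical_midpoint K y x.
    rewrite /m (canonical_midpoint_comb hKu hx hy hxy r0 s0 r2 s2).
    by rewrite (canonical_midpoint_comb hKu hy hx yx s0 r0 s2 r2)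
      (mulrC r) (addrC (s *: x)).
  rewrite midpointsC (aff_span_midpoints hKu hy hx yx s0 r0 s2 r2 (ltW lt)).
  rewrite ltr_sqrt // lt setIT (lin_span_face_endpoint hKu hy hx yx) //.
  exact: gt1 b0 a0 (ltW lt) ba.
- have Mle : Mratio K y x <= Mratio K x y by rewrite eqM.
  have a1 := gt1 _ _ a0 b0 Mle ab; have b1 := a1; rewrite eqM in b1.
  have sr : (s < r) = false by rewrite ltr_sqrt // eqM ltxx.
  rewrite (aff_span_midpoints hKu hx hy hxy r0 s0 r2 s2 Mle) sr setIC.
  have ey := lin_span_face_endpoint hKu hx hy hxy a1.
  have ex := lin_span_face_endpoint hKu hy hx yx b1.
  by congr (translate _ (_ `&` _)); apply/esym; [exact: ex | exact: ey].
Qed.
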